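(* Let $p_1,q_1,p_2,q_2$ be non-negative integers with $p_1>0$, $q_2>0$ and $\det Q:=p_1q_2-q_1p_2>0$, and let $\mathcal{M}\subseteq \mathcal{B}'$. Let $G_Q=G_Q(\mathcal{M})$ be the $Q$-subtraction game and $G=G(\mathcal{M})$ the subtraction game (defined in the context). Suppose $(X,Y)\in\mathcal{B}_Q$. Then $(X,Y)\in\mathcal{P}(G_Q)$ if and only if $\varphi_Q(X,Y)\in\mathcal{P}(G)$, where $$\varphi_Q(X,Y)=\left(\left\lfloor \frac{Xq_2-Yp_2}{\det Q}\right\rfloor,\left\lfloor\frac{Yp_1-Xq_1}{\det Q}\right\rfloor\right).$$ Equivalently: for $(A,B)\in\mathcal{B}$, $(A,B)\in\mathcal{P}(G)$ if and only if, for all $(x,y)\in\mathcal{T}_Q$, $(x+Ap_1+Bp_2,\ y+Aq_1+Bq_2)\in\mathcal{P}(G_Q)$.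
   Context: All games are impartial two-player games under normal play (a player who cannot move loses). A position is in $\mathcal{P}(G)$ (previous-player win) if none of its options is in $\mathcal{P}(G)$, and otherwise in $\mathcal{N}(G)$; terminal positions (no moves) are in $\mathcal{P}$. Let $\mathcal{B}$ be the set of ordered pairs of non-negative integers and $\mathcal{B}'=\mathcal{B}\setminus\{(0,0)\}$. Let $\mathcal{B}_Q=\{(X,Y)\in\mathcal{B}\mid Xq_1\le Yp_1 \text{ and } Yp_2\le Xq_2\}$. The subtraction game $G(\mathcal{M})$ has positions $\mathcal{B}$, and a move from $(A,B)$ to $(A-s,B-t)$ for any $(s,t)\in\mathcal{M}$ with $(A-s,B-t)\in\mathcal{B}$. The $Q$-subtraction game $G_Q(\mathcal{M})$ has positions $\mathcal{B}_Q$, and a move from $(X,Y)$ to $(X-p_1s-p_2t,\ Y-q_1s-q_2t)$ for any $(s,t)\in\mathcal{M}$ such that this pair lies in $\mathcal{B}_Q$. Let $\mathcal{T}_Q=\{(x,y)\in\mathcal{B}_Q\mid p_1(y-q_2)<q_1(x-p_2)\text{ and } p_2(y-q_1)>q_2(x-p_1)\}$. *)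

(* Defs.v *)
From HB Require Import structures.
From mathcomp Require Import all_boot all_order all_algebra.
From mathcomp Require Import boolp classical_sets.
From mathcomp Require Import zify.
Set Implicit Arguments. Unset Strict Implicit. Unset Printing Implicit Defensive.
Import Order.TTheory GRing.Theory Num.Theory.
Local Open Scope classical_set_scope.
Local Open Scope ring_scope.

Record game (T : Type) := Game {
  position : set T;
  options : T -> set T
}.

(* Outcome classes under normal play. For a terminating game these are the
   sets given by the recursion "P if no option is in P, otherwise N": see
   [P_positionE] and [N_positionE]. *)
Inductive P_position (T : Type) (G : game T) (x : T) : Prop :=
  | P_intro : position G x ->
      (forall y, options G x y -> N_position G y) -> P_position G x
with N_position (T : Type) (G : game T) (x : T) : Prop :=
  | N_intro y : position G x -> options G x y -> P_position G y ->
      N_position G x.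

Definition terminating (T : Type) (G : game T) : Prop :=
  (forall x y, position G x -> options G x y -> position G y) /\
  well_founded (fun y x => position G x /\ options G x y).

Lemma P_not_N (T : Type) (G : game T) : terminating G ->
  forall x, P_position G x -> ~ N_position G x.
Proof.
move=> [_ wfG]; elim/(well_founded_ind wfG) => x IH [px oP] [y _ xy Py].
exact: IH (oP _ xy).
Qed.

Lemma P_or_N (T : Type) (G : game T) : terminating G ->
  forall x, position G x -> P_position G x \/ N_position G x.
Proof.
move=> [posG wfG]; elim/(well_founded_ind wfG) => x IH px.
have [[y xy Py]|nP] := pselect (exists2 y, options G x y & P_position G y).
  by right; exists y.
left; split=> // y xy; case: (IH y) => // [|Py]; first exact: posG xy.
by case: nP; exists y.
Qed.

Lemma N_positionE (T : Type) (G : game T) : terminating G ->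
  forall x, position G x -> N_position G x <-> ~ P_position G x.
Proof.
move=> tG x px; split=> [Nx Px|nP]; first exact: P_not_N Px Nx.
by case: (P_or_N tG px).
Qed.

Lemma P_positionE (T : Type) (G : game T) : terminating G ->
  forall x, position G x ->
  P_position G x <-> (forall y, options G x y -> ~ P_position G y).
Proof.
move=> tG x px; have posG := tG.1; split=> [[_ oN] y xy|nP].
  by apply/(N_positionE tG (posG _ _ px xy)); exact: oN.
split=> // y xy; apply/(N_positionE tG (posG _ _ px xy)); exact: nP.
Qed.

Definition calB : set (int * int) := [set z | 0 <= z.1 /\ 0 <= z.2].

Definition calB' : set (int * int) := calB `\ (0, 0).

Definition detQ (p1 q1 p2 q2 : int) : int := p1 * q2 - q1 * p2.

Definition calBQ (p1 q1 p2 q2 : int) : set (int * int) :=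
  [set z | [/\ calB z, z.1 * q1 <= z.2 * p1 & z.2 * p2 <= z.1 * q2]].

Definition calTQ (p1 q1 p2 q2 : int) : set (int * int) :=
  [set z | [/\ calBQ p1 q1 p2 q2 z,
               p1 * (z.2 - q2) < q1 * (z.1 - p2)
             & p2 * (z.2 - q1) > q2 * (z.1 - p1)]].

Definition subtraction_game (M : set (int * int)) : game (int * int) :=
  {| position := calB;
     options := fun z =>
       [set (z.1 - m.1, z.2 - m.2) | m in M] `&` calB |}.

Definition Q_subtraction_game (p1 q1 p2 q2 : int) (M : set (int * int)) :
    game (int * int) :=
  {| position := calBQ p1 q1 p2 q2;
     options := fun z =>
       [set (z.1 - p1 * m.1 - p2 * m.2, z.2 - q1 * m.1 - q2 * m.2) | m in M]
       `&` calBQ p1 q1 p2 q2 |}.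

Definition floor_quot (a b : int) : int := Num.floor (a%:Q / b%:Q).

Definition phiQ (p1 q1 p2 q2 : int) (z : int * int) : int * int :=
  (floor_quot (z.1 * q2 - z.2 * p2) (detQ p1 q1 p2 q2),
   floor_quot (z.2 * p1 - z.1 * q1) (detQ p1 q1 p2 q2)).

Lemma terminating_subtraction_game (M : set (int * int)) :
  M `<=` calB' -> terminating (subtraction_game M).
Proof.
move=> MB'; split=> [x y _ []//|].
apply: (@Wf_nat.well_founded_lt_compat _ (fun z : int * int => absz (z.1 + z.2))).
move=> [c d] [a b] [[/= a0 b0]] [] [[s t] /MB' [[/= s0 t0] st0] [<- <-]] [/= c0 d0].
apply/ssrnat.ltP.
have : (s != 0) || (t != 0).
  by rewrite -negb_and; apply/negP => /andP[/eqP s1 /eqP t1]; apply: st0; rewrite s1 t1.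
lia.
Qed.

Lemma terminating_Q_subtraction_game (p1 q1 p2 q2 : int) (M : set (int * int)) :
  0 < p1 -> 0 <= q1 -> 0 <= p2 -> 0 < q2 -> M `<=` calB' ->
  terminating (Q_subtraction_game p1 q1 p2 q2 M).
Proof.
move=> p1_gt0 q1_ge0 p2_ge0 q2_gt0 MB'; split=> [x y _ []//|].
apply: (@Wf_nat.well_founded_lt_compat _ (fun z : int * int => absz (z.1 + z.2))).
move=> [c d] [a b] [[[/= a0 b0] _ _]] [].
move=> [[s t] /MB' [[/= s0 t0] st0] [<- <-]] [[/= c0 d0] _ _]; apply/ssrnat.ltP.
have : (s != 0) || (t != 0).
  by rewrite -negb_and; apply/negP => /andP[/eqP s1 /eqP t1]; apply: st0; rewrite s1 t1.
have := mulr_ge0 q1_ge0 s0; have := mulr_ge0 p2_ge0 t0.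
have : s <= p1 * s by rewrite ler_peMl //; lia.
have : t <= q2 * t by rewrite ler_peMl //; lia.
lia.
Qed.

(* Main.v *)
(** In the coordinates [u = X q2 - Y p2] and [v = Y p1 - X q1] the set [calBQ]
    is the quadrant [u, v >= 0], the Q-move [(s, t)] subtracts [det Q * s] from
    [u] and [det Q * t] from [v], and [calTQ] is the square [0 <= u, v < det Q].
    Hence dividing both coordinates by [det Q] and rounding down maps the
    options of a position of [G_Q] onto the options of its image in [G], and
    such a map preserves outcomes. *)
Require Import Defs.
From mathcomp Require Import all_boot all_order all_algebra.
From mathcomp Require Import boolp classical_sets.
From mathcomp Require Import zify ring.
Import Order.TTheory GRing.Theory Num.Theory.
Local Open Scope classical_set_scope.
Local Open Scope ring_scope.

(** Induction along the moves of [G]: on both sides P means that no option is P, and the equality of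
    option sets pairs every option of [f x] with one of [x]. *)
Lemma P_position_image (T U : Type) (G : game T) (H : game U) (f : T -> U) :
  terminating G -> terminating H ->
  (forall x, position G x -> position H (f x)) ->
  (forall x, position G x -> options H (f x) = f @` options G x) ->
  forall x, position G x -> P_position G x <-> P_position H (f x).
Proof.
move=> tG tH posf optf; have [posG wfG] := tG.
elim/(well_founded_ind wfG) => x IH px.
rewrite (P_positionE tG px) (P_positionE tH (posf _ px)) optf //.
split=> [nP _ [y xy <-]|nP y xy].
  by rewrite -IH //; [exact: nP | exact: posG xy].
by rewrite IH //; [apply: nP; exists y | exact: posG xy].
Qed.

Lemma floor_quotE (a b : int) : 0 < b -> floor_quot a b = (a %/ b)%Z.
Proof.
move=> b0; apply: floor_def.
have b0' : 0 < b%:Q by rewrite ltr0z.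
rewrite ler_pdivlMr // ltr_pdivrMr // -!intrM ler_int ltr_int.
by rewrite lez_floor ?ltz_ceil ?gt_eqF.
Qed.

Section QCoordinates.
Variables (p1 q1 p2 q2 : int).
Hypotheses (p1_gt0 : 0 < p1) (q1_ge0 : 0 <= q1) (p2_ge0 : 0 <= p2)
  (q2_gt0 : 0 < q2) (det_gt0 : 0 < detQ p1 q1 p2 q2).

Local Notation D := (detQ p1 q1 p2 q2).

Lemma calBQE (X Y : int) :
  calBQ p1 q1 p2 q2 (X, Y) <-> 0 <= X * q2 - Y * p2 /\ 0 <= Y * p1 - X * q1.
Proof.
split=> [[_ /= h1 h2]|[u0 v0]]; first by rewrite !subr_ge0.
split=> /=; [|by rewrite -subr_ge0|by rewrite -subr_ge0].
(* Inverting the coordinate change by Cramer's rule: [D * X] and [D * Y] are combinations of [u] and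
   [v] with non-negative coefficients. *)
split=> /=; rewrite -(pmulr_rge0 _ det_gt0).
  have -> : D * X = p1 * (X * q2 - Y * p2) + p2 * (Y * p1 - X * q1).
    by rewrite /detQ; ring.
  by rewrite addr_ge0 ?mulr_ge0 // ltW.
have -> : D * Y = q1 * (X * q2 - Y * p2) + q2 * (Y * p1 - X * q1).
  by rewrite /detQ; ring.
by rewrite addr_ge0 ?mulr_ge0 // ltW.
Qed.

(** The shift adds [s * D] to [u] and [t * D] to [v], and multiples of [D] pass through the floor.
    The signs of [s] and [t] are free, so this covers moves as well as translates of [calTQ]. *)
Lemma phiQ_shift (X Y s t : int) :
  phiQ p1 q1 p2 q2 (X + s * p1 + t * p2, Y + s * q1 + t * q2) =
  (s + (phiQ p1 q1 p2 q2 (X, Y)).1, t + (phiQ p1 q1 p2 q2 (X, Y)).2).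
Proof.
rewrite /phiQ /= !floor_quotE // -!divzMDl ?gt_eqF //.
by congr ((_ %/ _)%Z, (_ %/ _)%Z); rewrite /detQ; ring.
Qed.

(** A floored quotient by [D > 0] has the sign of its numerator. Hence a move is legal in one game
    exactly when its counterpart is legal in the other. *)
Lemma phiQ_calB (X Y : int) :
  calB (phiQ p1 q1 p2 q2 (X, Y)) <-> calBQ p1 q1 p2 q2 (X, Y).
Proof. by rewrite calBQE /calB /= !floor_quotE // !divz_ge0. Qed.

Lemma phiQ_calTQ (x y : int) :
  calTQ p1 q1 p2 q2 (x, y) -> phiQ p1 q1 p2 q2 (x, y) = (0, 0).
Proof.
case=> /calBQE[u0 v0] /= hv hu; rewrite /phiQ /= !floor_quotE //.
have D_ge0 : 0 <= D := ltW det_gt0.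
(* Expanded, [hu] and [hv] read [u < D] and [v < D]. *)
by rewrite !divz_small //= gez0_abs // ?u0 ?v0 /detQ /=; lia.
Qed.

Lemma calTQ0 : calTQ p1 q1 p2 q2 (0, 0).
Proof.
move: det_gt0; rewrite /detQ => d0.
by split; [apply/calBQE; rewrite !mul0r subr0 | move=> /=; lia | move=> /=; lia].
Qed.

Lemma P_position_phiQ (M : set (int * int)) (X Y : int) : M `<=` calB' ->
  calBQ p1 q1 p2 q2 (X, Y) ->
  P_position (Q_subtraction_game p1 q1 p2 q2 M) (X, Y) <->
  P_position (subtraction_game M) (phiQ p1 q1 p2 q2 (X, Y)).
Proof.
move=> MB'; apply: (@P_position_image _ _ (Q_subtraction_game p1 q1 p2 q2 M)
  (subtraction_game M) (phiQ p1 q1 p2 q2)).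
- exact: terminating_Q_subtraction_game.
- exact: terminating_subtraction_game.
- by move=> [x y] /phiQ_calB.
move=> [x y] _ /=.
have phiQ_move (s t : int) :
    phiQ p1 q1 p2 q2 (x - p1 * s - p2 * t, y - q1 * s - q2 * t) =
    ((phiQ p1 q1 p2 q2 (x, y)).1 - s, (phiQ p1 q1 p2 q2 (x, y)).2 - t).
  rewrite [_.1 - s]addrC [_.2 - t]addrC -phiQ_shift.
  by congr (phiQ _ _ _ _ (_, _)); ring.
(* In both inclusions the same [(s, t)] in [M] serves the two games. *)
apply/seteqP; split=> [_ [[[s t] Mst <-] Bst]|_ [_ [[[s t] Mst <-] Bst] <-]].
  exists (x - p1 * s - p2 * t, y - q1 * s - q2 * t); last exact: phiQ_move.
  by split; [exists (s, t) | apply/phiQ_calB; rewrite phiQ_move].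
by split; [exists (s, t); rewrite ?phiQ_move | apply/phiQ_calB].
Qed.

End QCoordinates.

Theorem theorem1 (p1 q1 p2 q2 : int) (M : set (int * int))
  (hp1 : 0 < p1) (hq1 : 0 <= q1) (hp2 : 0 <= p2) (hq2 : 0 < q2)
  (hdet : 0 < detQ p1 q1 p2 q2) (hM : M `<=` calB') :
  (forall X Y : int, calBQ p1 q1 p2 q2 (X, Y) ->
     P_position (Q_subtraction_game p1 q1 p2 q2 M) (X, Y) <->
     P_position (subtraction_game M) (phiQ p1 q1 p2 q2 (X, Y)))
  /\
  (forall A B : int, calB (A, B) ->
     P_position (subtraction_game M) (A, B) <->
     (forall x y : int, calTQ p1 q1 p2 q2 (x, y) ->
        P_position (Q_subtraction_game p1 q1 p2 q2 M)
          (x + A * p1 + B * p2, y + A * q1 + B * q2))).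
Proof.
split=> [X Y|A B AB]; first exact: P_position_phiQ.
have shift x y : calTQ p1 q1 p2 q2 (x, y) ->
    P_position (Q_subtraction_game p1 q1 p2 q2 M)
      (x + A * p1 + B * p2, y + A * q1 + B * q2) <->
    P_position (subtraction_game M) (A, B).
  move=> Txy.
  have phi_AB : phiQ p1 q1 p2 q2 (x + A * p1 + B * p2, y + A * q1 + B * q2)
      = (A, B) by rewrite phiQ_shift // phiQ_calTQ //= !addr0.
  by rewrite P_position_phiQ // ?phi_AB //; apply/phiQ_calB; rewrite ?phi_AB.
split=> [PAB x y Txy|PQ]; first by rewrite shift.
(* All translates share the outcome of [(A, B)], so one point of [calTQ] suffices; the origin is
   always there. *)
by rewrite -(shift 0 0); [apply: PQ|]; exact: calTQ0.
Qed.
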